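(* Let $m\ge5$ be odd, $N=3^m-1$ and $n=\frac{3^m-1}{2}$. Let $\beta$ be a primitive element of $\mathrm{GF}(3^m)$ (so $\beta^n=-1$). For $j\in\{1,3\}$ let $$g_{(j,m)}(x)=\prod_{\substack{1\le i\le N-1\\ \mathrm{wt}_3(i)\equiv j\ (\mathrm{mod}\ 4)}}(x-\beta^i)\in\mathrm{GF}(3)[x],$$ and let $\mathcal{C}_{(j,m)}$ be the ternary negacyclic code of length $n$ with generator polynomial $g_{(j,m)}(x)$. Then $\mathcal{C}_{(1,m)}$ has parameters $$\left[\frac{3^m-1}{2},\ \frac{3^m-1+2(-1)^{(m+1)/2}}{4},\ d\right],\quad d\ge\frac{3^{(m-1)/2}+2+(-1)^{(m-1)/2}}{4}+3,$$ and $\mathcal{C}_{(1,m)}^\perp=\mathcal{C}_{(3,m)}$, which has parameters $$\left[\frac{3^m-1}{2},\ \frac{3^m-1+2(-1)^{(m-1)/2}}{4},\ d^\perp\right],\quad d^\perp\ge\frac{3^{(m-1)/2}-(-1)^{(m-1)/2}}{4}+2.$$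
   Context: For $0\le i\le 3^m-1$ with $3$-adic expansion $i=\sum_{j=0}^{m-1}i_j3^j$, $i_j\in\{0,1,2\}$, the $3$-weight is $\mathrm{wt}_3(i)=\sum_j i_j$ (note $\mathrm{wt}_3(i)\equiv i\pmod 2$, so the indices in the product are odd and $g_{(j,m)}$ divides $x^n+1$). A ternary negacyclic code of length $n$ is an ideal of $\mathrm{GF}(3)[x]/(x^n+1)$, with codewords $(c_0,\dots,c_{n-1})\leftrightarrow\sum c_ix^i$. $[n,k,d]$ denotes length, dimension, minimum Hamming distance; $\perp$ is the Euclidean dual. *)

(* Defs.v *)
From HB Require Import structures.
From mathcomp Require Import all_boot all_order all_algebra.
Set Implicit Arguments. Unset Strict Implicit. Unset Printing Implicit Defensive.
Import Order.TTheory GRing.Theory Num.Theory.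
Local Open Scope ring_scope.

Definition wt3 (m i : nat) : nat := (\sum_(j < m) (i %/ 3 ^ j) %% 3)%N.

(* embedding of GF(3) = 'F_3 into a field F (of characteristic 3) *)
Definition F3toF (F : fieldType) (a : 'F_3) : F := (a : nat)%:R.

Definition gjm (F : fieldType) (m j : nat) (beta : F) : {poly F} :=
  \prod_(1 <= i < 3 ^ m - 1 | (wt3 m i %% 4 == j)%N) ('X - (beta ^+ i)%:P).

Definition wpoly (n : nat) (c : 'rV['F_3]_n) : {poly 'F_3} := \sum_(i < n) (c 0 i)%:P * 'X^i.

(* negacyclic code of length n with generator polynomial g (g | x^n + 1):
   the ideal (g) of GF(3)[x]/(x^n+1), i.e. the words whose polynomial is
   divisible by g (divisibility checked in F[x], g having coefficients in GF(3)) *)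
Definition negacyclic_code (F : fieldType) (n : nat) (g : {poly F})
  : {set 'rV['F_3]_n} :=
  [set c : 'rV['F_3]_n | g %| map_poly (@F3toF F) (wpoly c)].

Definition code_dim (n : nat) (C : {set 'rV['F_3]_n}) : nat :=
  \dim <<enum C>>%VS.

Definition hdist (n : nat) (c c' : 'rV['F_3]_n) : nat :=
  #|[set i : 'I_n | c 0 i != c' 0 i]|.

Definition dual_code (n : nat) (C : {set 'rV['F_3]_n}) : {set 'rV['F_3]_n} :=
  [set c : 'rV['F_3]_n | [forall c' in C, \sum_(i < n) c 0 i * c' 0 i == 0]].

(* Main.v *)
Require Import Defs.
From HB Require Import structures.
From mathcomp Require Import all_boot all_order all_algebra all_field.
From mathcomp Require Import zify ring.
Import Order.TTheory GRing.Theory Num.Theory.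
Local Open Scope ring_scope.

(* Write m = 2h + 1.  For x < 3^k with k <= h, the exponents
   (3^h - 1 - x) + 3^h (x + 3^k y) form an arithmetic progression of difference
   3^h - 1, and since the digits of 3^h - 1 - x are complementary to those of x,
   they all have 3-weight 2h + wt_3(y).  As gcd(3^h - 1, 3^m - 1) = 2, the BCH
   bound applies: y = 1 and k = h give distance more than 3^h for the class of
   m modulo 4, and y = 7 = (21)_3 and k = h - 1 give distance more than 3^(h-1)
   for the class of m + 2; both reach the claimed bounds.
   The dimensions come from counting the weights modulo 4: the numbers A_m(j) of
   i < 3^m of weight j modulo 4 satisfy A_(m+1)(j) + A_m(j+1) = 3^m.
   Orthogonality of the two codes is Parseval's identity, and the dimensions add
   up to n. *)

(** * The 3-weight *)

Lemma wt3S m i : wt3 m.+1 i = (i %% 3 + wt3 m (i %/ 3))%N.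
Proof.
rewrite /wt3 big_ord_recl expn0 divn1; congr addn.
by apply: eq_bigr => j _; rewrite /bump expnS divnMA.
Qed.

Lemma wt3_cat a b x y : (x < 3 ^ a)%N ->
  wt3 (a + b) (x + 3 ^ a * y) = (wt3 a x + wt3 b y)%N.
Proof.
elim: a x => [|a IHa] x.
  by rewrite expn0 ltnS leqn0 => /eqP ->; rewrite mul1n /wt3 big_ord0.
rewrite expnS => ltx; rewrite addSn !wt3S -mulnA.
set z := (3 ^ a * y)%N.
have -> : ((x + 3 * z) %% 3 = x %% 3)%N by lia.
have -> : ((x + 3 * z) %/ 3 = x %/ 3 + z)%N by lia.
by rewrite IHa ?addnA //; lia.
Qed.

Lemma wt3_0 m : wt3 m 0 = 0.
Proof. by rewrite /wt3 big1 // => i _; rewrite div0n. Qed.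

Lemma wt3_widen k h x : (k <= h)%N -> (x < 3 ^ k)%N -> wt3 h x = wt3 k x.
Proof.
move=> /subnKC <- ltx.
by rewrite -[x in LHS]addn0 -(muln0 (3 ^ k)%N) wt3_cat // wt3_0 addn0.
Qed.

(** All digits of [3 ^ m - 1] are 2, so subtracting [x] never borrows and turns each digit [d] into
    [2 - d]. *)
Lemma wt3_compl m x : (x < 3 ^ m)%N ->
  (wt3 m x + wt3 m (3 ^ m - 1 - x) = m.*2)%N.
Proof.
elim: m x => [|m IHm] x; first by rewrite /wt3 !big_ord0.
rewrite expnS => ltx; rewrite !wt3S.
have {}IHm := IHm (x %/ 3)%N.
have -> : ((3 * 3 ^ m - 1 - x) %/ 3 = 3 ^ m - 1 - x %/ 3)%N by lia.
lia.
Qed.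

Lemma odd_wt3 m x : (x < 3 ^ m)%N -> odd (wt3 m x) = odd x.
Proof.
elim: m x => [|m IHm] x; first by case: x; rewrite /wt3 ?big_ord0.
rewrite expnS => ltx; rewrite wt3S oddD IHm; lia.
Qed.

(* [3 * i] modulo [3 ^ m - 1] is the cyclic shift of the digits of [i]. *)
Lemma wt3_shift m i : (i < 3 ^ m - 1)%N ->
  wt3 m ((3 * i) %% (3 ^ m - 1)) = wt3 m i.
Proof.
case: m => [|m] lti; first by rewrite /wt3 !big_ord0.
set y := (i %% 3 ^ m)%N; set d := (i %/ 3 ^ m)%N.
have p3 : (0 < 3 ^ m)%N by rewrite expn_gt0.
have lty : (y < 3 ^ m)%N by rewrite ltn_mod.
have iE : i = (y + 3 ^ m * d)%N by rewrite addnC mulnC -divn_eq.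
have ltd : (d < 3)%N by rewrite ltn_divLR // -expnS; lia.
have -> : ((3 * i) %% (3 ^ m.+1 - 1) = d + 3 * y)%N.
  have -> : (3 * i = d * (3 ^ m.+1 - 1) + (d + 3 * y))%N.
    by rewrite iE expnS; nia.
  rewrite modnMDl modn_small //.
  by move: lti; rewrite iE expnS; nia.
rewrite wt3S [in RHS]iE -[in RHS]addn1 wt3_cat //.
have -> : wt3 1 d = d by rewrite wt3S /wt3 big_ord0 addn0 modn_small.
have -> : ((d + 3 * y) %/ 3 = y)%N by lia.
lia.
Qed.

Lemma wt3_progression h k l x y : (k <= h)%N -> (x < 3 ^ k)%N ->
  wt3 (h + (k + l)) (3 ^ h - 1 - x + 3 ^ h * (x + 3 ^ k * y))
    = (h.*2 + wt3 l y)%N.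
Proof.
move=> lekh ltx; have ltxh : (x < 3 ^ h)%N.
  by rewrite (leq_trans ltx) // leq_exp2l.
have := wt3_compl _ _ ltxh; rewrite (wt3_widen _ _ _ lekh ltx) => wtx.
by rewrite !wt3_cat //; lia.
Qed.

(** * Counting integers by their 3-weight modulo 4 *)

Lemma sum_nat_mul3 (f : nat -> nat) k :
  (\sum_(0 <= i < 3 * k) f i
    = \sum_(0 <= q < k) (f (3 * q) + f (3 * q).+1 + f (3 * q).+2))%N.
Proof.
elim: k => [|k IHk]; first by rewrite muln0 !big_geq.
have -> : (3 * k.+1 = (3 * k).+3)%N by lia.
by rewrite !big_nat_recr //= IHk !addnA.
Qed.

Definition wt3_count m j : nat := \sum_(0 <= i < 3 ^ m) (wt3 m i %% 4 == j).

(** A lowest digit added to [q] of weight [w] gives weights [w], [w + 1], [w + 2]: every class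
    modulo 4 but [w + 3], and [w + 3] is the class [j] exactly when [w] is in the class [j + 1]. So
    each [q] contributes 1 to the sum. *)
Lemma wt3_countS m j : (j < 4)%N ->
  (wt3_count m.+1 j + wt3_count m (j.+1 %% 4) = 3 ^ m)%N.
Proof.
move=> ltj; rewrite /wt3_count expnS sum_nat_mul3 -big_split /=.
rewrite -[RHS](subn0 (3 ^ m)%N) -[RHS]muln1 -sum_nat_const_nat.
apply: eq_bigr => q _; rewrite !wt3S.
have -> : ((3 * q) %/ 3 = q)%N by lia.
have -> : ((3 * q).+1 %/ 3 = q)%N by lia.
have -> : ((3 * q).+2 %/ 3 = q)%N by lia.
have -> : ((3 * q) %% 3 = 0)%N by lia.
have -> : ((3 * q).+1 %% 3 = 1)%N by lia.
have -> : ((3 * q).+2 %% 3 = 2)%N by lia.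
rewrite add0n -(modnDmr 1) -(modnDmr 2).
have := ltn_pmod (wt3 m q) (isT : (0 < 4)%N).
by case: (_ %% 4)%N => [|[|[|[|]]]] //; case: j ltj => [|[|[|[|]]]].
Qed.

(** Two steps of the recurrence give A_(m+2)(1) = 2 * 3^m + A_m(3), and likewise with 1 and 3
    exchanged; this exchange makes the sign alternate with [h]. *)
Lemma wt3_count_odd h :
  ((wt3_count h.*2.+1 1)%:Z * 4 = (3 ^ h.*2.+1)%:Z - 1 + 2 * (-1) ^+ h) /\
  ((wt3_count h.*2.+1 3)%:Z * 4 = (3 ^ h.*2.+1)%:Z - 1 - 2 * (-1) ^+ h).
Proof.
elim: h => [|h [IH1 IH3]].
  have count1 j : wt3_count 1 j = ((0 == j) + (1 == j) + (2 == j))%N.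
    by rewrite /wt3_count expn1 !big_nat_recr //= big_geq // !wt3S /wt3 !big_ord0.
  by rewrite !count1.
have e1 := @wt3_countS h.*2.+2 1 isT; have e2 := @wt3_countS h.*2.+1 2 isT.
have e3 := @wt3_countS h.*2.+2 3 isT; have e0 := @wt3_countS h.*2.+1 0 isT.
rewrite doubleS exprS mulN1r; move: e1 e2 e3 e0 IH1 IH3.
rewrite modnn !modn_small //.
rewrite !(expnS 3 h.*2.+2) !(expnS 3 h.*2.+1).
move: ((-1) ^+ h : int) (wt3_count h.*2.+1 1) (wt3_count h.*2.+1 3) => e a b.
move: (wt3_count h.*2.+2 0) (wt3_count h.*2.+2 2) (3 ^ h.*2.+1)%N => c d p.
by move: (wt3_count h.*2.+3 1) (wt3_count h.*2.+3 3) => a' b'; lia.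
Qed.

(** * Linear codes *)

Lemma wpolyE n (c : 'rV['F_3]_n) : wpoly c = rVpoly c.
Proof.
apply/polyP => k; rewrite coef_sum coef_rVpoly.
case: insubP => [i _ <-|]; last first.
  rewrite -leqNgt => le_nk; apply: big1 => i _.
  by rewrite coefCM coefXn gtn_eqF ?mulr0 // (leq_trans (ltn_ord i)).
rewrite (bigD1 i) //= coefCM coefXn eqxx mulr1 big1 ?addr0 // => j ne_ji.
by rewrite coefCM coefXn [_ == _]eq_sym (inj_eq val_inj) (negPf ne_ji) mulr0.
Qed.

Lemma code_dim_rowspace k n (G : 'M['F_3]_(k, n)) :
  code_dim [set c : 'rV_n | (c <= G)%MS] = \rank G.
Proof.
set B := row_base G; pose X := [tuple row i B | i < \rank G].
have X_i (i : 'I_(\rank G)) : X`_i = row i B by rewrite (nth_mktuple _ _ i).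
have freeX : free X.
  apply/freeP => u; under eq_bigr do rewrite X_i.
  move=> u0 i; have : (\row_j u j) *m B = 0.
    by rewrite mulmx_sum_row -[RHS]u0; apply: eq_bigr => j _; rewrite mxE.
  rewrite -(mul0mx _ B) => /(row_free_inj (row_base_free G))/rowP/(_ i).
  by rewrite !mxE.
suff -> : code_dim [set c : 'rV_n | (c <= G)%MS] = \dim <<X>>%VS.
  by rewrite (eqP freeX) size_tuple.
congr (\dim _); apply/eqP; rewrite eqEsubv; apply/andP; split.
  apply/span_subvP => c; rewrite mem_enum inE => cG.
  have /submxP[u ->] : (c <= B)%MS by rewrite eq_row_base.
  rewrite mulmx_sum_row memv_suml // => i _.
  by rewrite memvZ // memv_span // -X_i mem_nth // size_tuple.
apply/span_subvP => _ /tnthP[i ->]; rewrite tnth_mktuple.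
by rewrite memv_span // mem_enum inE (submx_trans (row_sub i B)) // eq_row_base.
Qed.

Lemma dot_mulmx_tr n (c c' : 'rV['F_3]_n) :
  c *m c'^T = (\sum_(i < n) c 0 i * c' 0 i)%:M.
Proof.
rewrite [LHS]mx11_scalar; congr _%:M; rewrite mxE.
by apply: eq_bigr => i _; rewrite mxE.
Qed.

Lemma dual_code_rowspace k n (G : 'M['F_3]_(k, n)) :
  dual_code [set c : 'rV_n | (c <= G)%MS]
    = [set c : 'rV_n | (c <= kermx G^T)%MS].
Proof.
apply/setP => c; rewrite !inE; apply/'forall_implyP/sub_kermxP => [cG | cG c'].
  apply: trmx_inj; rewrite trmx_mul trmxK trmx0; apply/row_matrixP => i.
  have := cG (row i G); rewrite inE row_sub => /(_ isT)/eqP dot0.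
  apply: trmx_inj; rewrite row0 trmx0 row_mul trmx_mul trmxK.
  by rewrite dot_mulmx_tr dot0 raddf0.
rewrite inE => /submxP[u def_c'].
have: c *m c'^T = 0 by rewrite def_c' trmx_mul mulmxA cG mul0mx.
by rewrite dot_mulmx_tr => /matrixP/(_ 0 0); rewrite !mxE /= mulr1n => ->.
Qed.

(** Orthogonality puts the rows of [H] in the kernel of [G^T], whose rank [n - \rank G] equals
    [\rank H]. *)
Lemma dual_code_orthogonal k l n (G : 'M['F_3]_(k, n)) (H : 'M['F_3]_(l, n)) :
  (\rank G + \rank H = n)%N ->
  (forall c c' : 'rV_n, (c <= G)%MS -> (c' <= H)%MS ->
     \sum_(i < n) c 0 i * c' 0 i = 0) ->
  dual_code [set c : 'rV_n | (c <= G)%MS] = [set c : 'rV_n | (c <= H)%MS].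
Proof.
move=> rankGH orthGH.
have sHG : (H <= kermx G^T)%MS.
  apply/row_subP => i.
  have : row i H \in dual_code [set c : 'rV_n | (c <= G)%MS].
    rewrite inE; apply/'forall_implyP => c; rewrite inE => cG; apply/eqP.
    under eq_bigr do rewrite mulrC.
    exact: orthGH (row_sub i H).
  by rewrite dual_code_rowspace inE.
have /eqmxP eqHG : (H == kermx G^T)%MS.
  by rewrite -(mxrank_leqif_eq sHG) mxrank_ker mxrank_tr
     -[X in _ == (X - _)%N]rankGH addKn.
by rewrite dual_code_rowspace; apply/setP => c; rewrite !inE eqHG.
Qed.

(** * Generator matrix of the multiples of a polynomial *)

Section MultiplesMatrix.

Variables (K : fieldType) (k n : nat) (g : {poly K}).

(** The encoding map of the code generated by [g]. Under [size_gk] below, the product fits in length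
    [n], so [poly_rV] truncates nothing. *)
Definition multiple_word (u : 'rV[K]_k) : 'rV[K]_n := poly_rV (g * rVpoly u).

Fact multiple_word_linear : linear multiple_word.
Proof.
by move=> a u v; rewrite /multiple_word linearP mulrDr -scalerAr linearP.
Qed.

HB.instance Definition _ :=
  GRing.isLinear.Build K 'rV[K]_k 'rV[K]_n _ multiple_word multiple_word_linear.

Hypotheses (nz_g : g != 0) (size_gk : ((size g).-1 + k)%N = n).

Lemma rVpoly_multiple_word u : rVpoly (multiple_word u) = g * rVpoly u.
Proof.
rewrite poly_rV_K // (leq_trans (size_polyMleq _ _)) // -size_gk.
have := size_poly k (fun i => if insub i is Some j then u 0 j else 0).
rewrite -[\poly_(i < k) _]/(rVpoly u).
rewrite -(prednK (_ : 0 < size g)%N) ?size_poly_gt0 //.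
by rewrite addSn leq_add2l.
Qed.

Lemma row_free_multiples : row_free (lin1_mx multiple_word).
Proof.
apply: inj_row_free => u; rewrite mul_rV_lin1 => u0.
have /eqP := rVpoly_multiple_word u; rewrite u0 linear0 eq_sym mulf_eq0.
by rewrite (negPf nz_g) => /eqP pu0; rewrite -(rVpolyK u) pu0 linear0.
Qed.

Lemma sub_multiples c :
  (c <= lin1_mx multiple_word)%MS = (g %| rVpoly c).
Proof.
apply/submxP/dvdpP => [[u ->]|[q def_c]].
  by exists (rVpoly u); rewrite mul_rV_lin1 rVpoly_multiple_word mulrC.
exists (poly_rV q); rewrite mul_rV_lin1; apply: (can_inj rVpolyK).
rewrite rVpoly_multiple_word poly_rV_K 1?mulrC //.
have [-> | nz_q] := eqVneq q 0; first by rewrite size_poly0.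
have := size_poly n (fun i => if insub i is Some j then c 0 j else 0).
rewrite -[\poly_(i < n) _]/(rVpoly c) def_c size_mul // -size_gk.
rewrite -(prednK (_ : 0 < size g)%N) ?size_poly_gt0 //.
by rewrite addnS /= addnC leq_add2l.
Qed.

End MultiplesMatrix.

(** * Zeros of codewords *)

(* The product of ['X - delta ^+ i] over all but one support position [i] has
   degree less than [L], and the hypothesis says that the weighted sum over the
   positions of the values of any such polynomial is zero. *)
Lemma bch_bound (F : fieldType) (n L : nat) (a : 'I_n -> F) (gamma delta : F) :
  gamma != 0 -> injective (fun i : 'I_n => delta ^+ i) ->
  (forall t, (t < L)%N -> \sum_(i < n) a i * (gamma * delta ^+ t) ^+ i = 0) ->
  (exists i, a i != 0) -> (L < #|[set i | a i != 0%R]|)%N.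
Proof.
move=> nz_gamma inj_delta zeros [i0 nz_i0]; rewrite ltnNge; apply/negP => leSL.
set S := [set i | a i != 0%R] in leSL.
have zero_poly (p : {poly F}) : (size p <= L)%N ->
    \sum_(i < n) a i * gamma ^+ i * p.[delta ^+ i] = 0.
  move=> sp; under eq_bigr do rewrite (horner_coef_wide _ sp) mulr_sumr.
  rewrite exchange_big big1 //= => t _.
  transitivity (p`_t * \sum_(i < n) a i * (gamma * delta ^+ t) ^+ i).
    rewrite mulr_sumr.
    by apply: eq_bigr => i _; rewrite exprMn -!exprM [(t * i)%N]mulnC; ring.
  by rewrite zeros ?mulr0.
have S_i0 : i0 \in S by rewrite inE.
pose p := \prod_(i <- enum (S :\ i0)) ('X - (delta ^+ i)%:P).
(* [p] has [#|S| - 1] roots, hence size [#|S|]. In its weighted sum only the term at [i0] survives,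
   and that term is nonzero. *)
have/zero_poly : (size p <= L)%N.
  by rewrite size_prod_XsubC -cardE (leq_trans _ leSL) //
     [#|S|](cardsD1 i0) S_i0.
rewrite (bigD1 i0) //= big1 ?addr0 => [/eqP|i ne_i].
  rewrite !mulf_eq0 expf_eq0 (negPf nz_i0) (negPf nz_gamma) andbF /=.
  rewrite horner_prod prodf_seq_eq0 => /hasP[i]; rewrite mem_enum !inE /=.
  case/andP=> ne_i _; rewrite !hornerE subr_eq0 => /eqP/inj_delta eq_i.
  by rewrite eq_i eqxx in ne_i.
have [-> | nz_ai] := eqVneq (a i) 0; first by rewrite !mul0r.
rewrite horner_prod (bigD1_seq i) ?enum_uniq ?mem_enum ?inE ?ne_i //=.
by rewrite hornerXsubC subrr mul0r mulr0.
Qed.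

Section Embedding.

Variables (F : fieldType) (charF3 : 3 \in [pchar F]).

(* [F3toF] is a ring morphism only in characteristic 3. *)
Definition F3emb (_ : 3 \in [pchar F]) (a : 'F_3) : F := F3toF F a.

Fact F3emb_nmod_morphism : nmod_morphism (F3emb charF3).
Proof.
split=> // x y; rewrite /F3emb /F3toF -natrD.
by rewrite -(GRing.natr_mod_pchar charF3 (x + y)).
Qed.

Fact F3emb_monoid_morphism : monoid_morphism (F3emb charF3).
Proof.
split=> // x y; rewrite /F3emb /F3toF -natrM.
by rewrite -(GRing.natr_mod_pchar charF3 (x * y)).
Qed.

HB.instance Definition _ :=
  GRing.isNmodMorphism.Build 'F_3 F (F3emb charF3) F3emb_nmod_morphism.
HB.instance Definition _ :=
  GRing.isMonoidMorphism.Build 'F_3 F (F3emb charF3) F3emb_monoid_morphism.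

(** The roots of [x ^+ 3 - x] are 0, 1 and -1. The sigma type lets the preimages serve as
    coefficients of a polynomial. *)
Lemma cube_id_F3emb (x : F) : x ^+ 3 = x -> {a | F3emb charF3 a = x}.
Proof.
move=> x3; have [-> | nz_x] := eqVneq x 0; first by exists 0.
have [-> | nx1] := eqVneq x 1; first by exists 1.
exists (- 1); rewrite rmorphN1; apply/esym/eqP; rewrite -addr_eq0.
have /eqP : x * (x - 1) * (x + 1) = 0.
  by transitivity (x ^+ 3 - x); [ring | rewrite x3 subrr].
by rewrite !mulf_eq0 (negPf nz_x) subr_eq0 (negPf nx1).
Qed.

Lemma Frobenius_fixed_poly (g : {poly F}) :
  map_poly (pFrobenius_aut charF3) g = g ->
  exists g0, map_poly (F3emb charF3) g0 = g.
Proof.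
move=> gF; have coef3 i : g`_i ^+ 3 = g`_i.
  by rewrite -[in RHS]gF coef_map /= pFrobenius_autE.
pose g0 := \poly_(i < size g) sval (cube_id_F3emb _ (coef3 i)).
exists g0; apply/polyP => i; rewrite coef_map coef_poly.
case: ltnP => [_|leg]; first by case: (cube_id_F3emb _ _).
by rewrite nth_default //; apply: rmorph0.
Qed.

Definition word_eval {n} (c : 'rV['F_3]_n) (x : F) : F :=
  \sum_(i < n) F3emb charF3 (c 0 i) * x ^+ i.

Lemma horner_map_wpoly n (c : 'rV['F_3]_n) x :
  (map_poly (@F3toF F) (wpoly c)).[x] = word_eval c x.
Proof.
rewrite -[@F3toF F]/(F3emb charF3) rmorph_sum horner_sum.
apply: eq_bigr => i _.
by rewrite rmorphM /= map_polyC map_polyXn hornerCM hornerXn.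
Qed.

End Embedding.

Arguments F3emb {F} charF3 a.
Arguments word_eval {F} charF3 {n} c x.
Arguments horner_map_wpoly {F} charF3 {n} c x.

(** * The codes defined by the 3-weight modulo 4 *)

Section WeightCodes.

Variables (F : fieldType) (charF3 : 3 \in [pchar F]) (m : nat) (beta : F).
Hypothesis prim_beta : (3 ^ m - 1)%N.-primitive_root beta.

Lemma beta_neq0 : beta != 0.
Proof.
apply: contra_eq_neq (prim_expr_order prim_beta) => ->.
by rewrite expr0n gtn_eqF ?(prim_order_gt0 prim_beta) // eq_sym oner_eq0.
Qed.

Definition wt3_exponents j : seq nat :=
  [seq i <- index_iota 1 (3 ^ m - 1) | (wt3 m i %% 4 == j)%N].

Definition gjm_roots j : seq F := [seq beta ^+ i | i <- wt3_exponents j].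

Lemma mem_wt3_exponents i j :
  (i \in wt3_exponents j) = [&& 0 < i, i < 3 ^ m - 1 & wt3 m i %% 4 == j]%N.
Proof. by rewrite mem_filter mem_index_iota andbC andbA. Qed.

Lemma gjmE j : gjm m j beta = \prod_(z <- gjm_roots j) ('X - z%:P).
Proof. by rewrite big_map big_filter. Qed.

Lemma uniq_gjm_roots j : uniq (gjm_roots j).
Proof.
rewrite map_inj_in_uniq ?filter_uniq ?iota_uniq // => i i'.
rewrite !mem_wt3_exponents => /and3P[_ lti _] /and3P[_ lti' _] /eqP.
by rewrite (eq_prim_root_expr prim_beta) !modn_small // => /eqP.
Qed.

(** [wt3_count] also ranges over 0 and [3 ^ m - 1], but their weights 0 and 2m are even, so they are
    not counted for odd [j]. *)
Lemma size_gjm_roots j : odd j -> size (gjm_roots j) = wt3_count m j.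
Proof.
move=> odd_j; rewrite size_map size_filter -sum1_count big_mkcond /=.
have Npos : (0 < 3 ^ m - 1)%N := prim_order_gt0 prim_beta.
have -> : wt3_count m j = (\sum_(0 <= i < (3 ^ m - 1).+1) (wt3 m i %% 4 == j))%N.
  by rewrite /wt3_count -subSn ?subn1 // expn_gt0.
rewrite [RHS]big_nat_recr //= [in RHS]big_ltn // wt3_0.
have -> : (0 %% 4 == j)%N = false by case: j odd_j.
have -> : (wt3 m (3 ^ m - 1) %% 4 == j)%N = false.
  have := wt3_compl m 0; rewrite expn_gt0 subn0 wt3_0 => /(_ isT).
  by move=> wtN; apply/negP => /eqP; lia.
by rewrite addn0 add0n; apply: eq_bigr => i _; case: eqP.
Qed.

Lemma in_weight_code n j (c : 'rV['F_3]_n) :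
  reflect (forall i, i \in wt3_exponents j -> word_eval charF3 c (beta ^+ i) = 0)
          (c \in negacyclic_code n (gjm m j beta)).
Proof.
rewrite inE gjmE; apply: (iffP idP) => [dvd_g i Pi | zeros].
  rewrite -horner_map_wpoly; apply/rootP; rewrite -dvdp_XsubCl.
  apply: dvdp_trans dvd_g; rewrite dvdp_XsubCl root_prod_XsubC.
  exact: map_f.
rewrite uniq_roots_dvdp ?uniq_rootsE ?uniq_gjm_roots //.
apply/allP => _ /mapP[i Pi ->]; apply/rootP.
by rewrite (horner_map_wpoly charF3) zeros.
Qed.

(** Frobenius sends [beta ^+ i] to [beta ^+ (3 * i)], a cyclic shift of the digits of [i]; it thus
    permutes the roots and fixes the product. *)
Lemma gjm_descent j :
  exists g0, map_poly (F3emb charF3) g0 = gjm m j beta.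
Proof.
apply: Frobenius_fixed_poly; rewrite {1}gjmE map_prod_XsubC /=.
rewrite -(big_map (pFrobenius_aut charF3) xpredT (fun z => 'X - z%:P)) gjmE.
apply: perm_big.
have uniq_Fr : uniq [seq pFrobenius_aut charF3 z | z <- gjm_roots j].
  by rewrite map_inj_uniq ?uniq_gjm_roots //; apply: fmorph_inj.
have sub_Fr : {subset [seq pFrobenius_aut charF3 z | z <- gjm_roots j]
                 <= gjm_roots j}.
  move=> _ /mapP[_ /mapP[i Pi ->] ->]; rewrite pFrobenius_autE -exprM mulnC.
  rewrite -(prim_expr_mod prim_beta); apply: map_f; move: Pi.
  rewrite !mem_wt3_exponents => /and3P[i_gt0 lti wti].
  rewrite ltn_mod wt3_shift // wti andbT; apply/andP; split; last by lia.
  (* The shifted exponent is nonzero: 3 is coprime to [3 ^ m - 1], which would otherwise divide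
     [i]. *)
  rewrite lt0n; apply/negP; rewrite -/(dvdn _ _) Gauss_dvdr.
    by move/(dvdn_leq i_gt0); lia.
  case: (m) lti => [|m'] //; rewrite expnS => _.
  rewrite coprime_sym prime_coprime //; have := expn_gt0 3 m'.
  by move=> p3; apply/negP; lia.
have [_ eq_mem] := uniq_min_size uniq_Fr sub_Fr (eq_leq (esym (size_map _ _))).
exact: uniq_perm (uniq_gjm_roots j) eq_mem.
Qed.

(** The descended generator has degree [wt3_count m j], and divisibility over [F] and over ['F_3]
    agree. *)
Lemma weight_code_matrix n j : odd j -> (wt3_count m j <= n)%N ->
  exists2 G : 'M['F_3]_(n - wt3_count m j, n), row_free G &
    negacyclic_code n (gjm m j beta) = [set c : 'rV_n | (c <= G)%MS].
Proof.
move=> odd_j le_n; have [g0 def_g] := gjm_descent j.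
have size_g0 : size g0 = (wt3_count m j).+1.
  by rewrite -(size_map_poly (F3emb charF3)) def_g gjmE
     size_prod_XsubC size_gjm_roots.
have nz_g0 : g0 != 0 by rewrite -size_poly_gt0 size_g0.
have size_g0k : ((size g0).-1 + (n - wt3_count m j))%N = n.
  by rewrite size_g0 /= subnKC.
exists (lin1_mx (multiple_word _ (n - wt3_count m j) n g0)).
  exact: row_free_multiples.
apply/setP => c; rewrite !inE sub_multiples // -wpolyE -def_g.
by rewrite -[@F3toF F]/(F3emb charF3) dvdp_map.
Qed.

Lemma weight_code_distance n j h k l y (c c' : 'rV['F_3]_n) :
    n.*2 = (3 ^ m - 1)%N -> m = h.*2.+1 -> (k <= h)%N -> m = (h + (k + l))%N ->
    (0 < y < 3 ^ l - 1)%N -> ((h.*2 + wt3 l y) %% 4 = j)%N ->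
    c \in negacyclic_code n (gjm m j beta) ->
    c' \in negacyclic_code n (gjm m j beta) -> c != c' ->
  (3 ^ k < hdist c c')%N.
Proof.
move=> def_n def_m lekh def_m' /andP[y_gt0 lty] wty /in_weight_code Cc.
move=> /in_weight_code Cc' ne_c; set s := (3 ^ h - 1)%N.
(* [e0] is the exponent of [wt3_progression] at [x = 0], and [s] is the common difference. *)
pose e0 := (s + 3 ^ h * (3 ^ k * y))%N.
have nz_beta := beta_neq0.
have h3_gt0 : (0 < 3 ^ h)%N by rewrite expn_gt0.
have -> : hdist c c' =
    #|[set i | F3emb charF3 (c 0 i) - F3emb charF3 (c' 0 i) != 0%R]|.
  by apply: eq_card => i; rewrite !inE subr_eq0 (inj_eq (fmorph_inj _)).
apply: (@bch_bound _ _ _ _ (beta ^+ e0) (beta ^+ s)).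
- by rewrite expf_neq0.
- move=> i i' /eqP; rewrite -!exprM (eq_prim_root_expr prim_beta) => eq_s.
  apply/val_inj; wlog le_i : i i' eq_s / (i' <= i)%N => [th|].
    by case: (leqP i' i) => [|/ltnW] /th -> //; rewrite eq_sym.
  move: eq_s; rewrite eqn_mod_dvd ?leq_mul2l ?le_i ?orbT // -mulnBr -def_n.
  have def_s : s = (s./2).*2.
    by rewrite even_halfK // oddB // oddX orbT.
  (* Half of 3^(2h+1) - 1 = 3 (3^h + 1) (3^h - 1) + 2. It shows that [s./2] is coprime to [n], so
     [n] divides [i - i'], which is less than [n]. *)
  have n_mod : n = (3 * (3 ^ h + 1) * s./2 + 1)%N.
    apply: double_inj; rewrite def_n def_m expnS -addnn expnD doubleD.
    by rewrite doubleMr -def_s /s; nia.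
  rewrite def_s -doubleMl -!muln2 dvdn_pmul2r // Gauss_dvdr; last first.
    by rewrite n_mod coprime_sym /coprime gcdnMDl gcdn1.
  have := ltn_ord i; case: (posnP (i - i')%N) => [|i_gt0 lti /(dvdn_leq i_gt0)].
    by move=> *; rewrite /=; lia.
  by lia.
- move=> x ltx; have E : (e0 + s * x)%N \in wt3_exponents j.
    have k3_gt0 : (0 < 3 ^ k)%N by rewrite expn_gt0.
    have lekh3 : (3 ^ k <= 3 ^ h)%N by rewrite leq_exp2l.
    have -> : (e0 + s * x = 3 ^ h - 1 - x + 3 ^ h * (x + 3 ^ k * y))%N.
      by rewrite /e0 /s; nia.
    rewrite mem_wt3_exponents {2}def_m' wt3_progression // wty eqxx andbT.
    rewrite addn_gt0 !muln_gt0 h3_gt0 addn_gt0 muln_gt0 k3_gt0 y_gt0 !orbT /=.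
    have -> : (3 ^ m = 3 ^ h * (3 ^ k * 3 ^ l))%N by rewrite def_m' !expnD.
    (* The upper bound on [y] keeps the whole progression below [3 ^ m - 1]. *)
    have le_k : (x + 3 ^ k * y < 3 ^ k * 3 ^ l - 1)%N by nia.
    by nia.
  rewrite -exprM -exprD.
  have := subrr (0 : F); rewrite -{1}(Cc _ E) -{1}(Cc' _ E) -sumrB => Csub.
  by rewrite -[RHS]Csub; apply: eq_bigr => i _; rewrite mulrBl.
apply/existsP; apply: contraNT ne_c; rewrite negb_exists => /forallP eq_c.
apply/eqP/rowP => i; have := eq_c i.
by rewrite negbK subr_eq0 (inj_eq (fmorph_inj _)) => /eqP.
Qed.

(** Fourier orthogonality over the roots of x^n + 1, the odd powers of [beta]. For [i != i'] it is a
    geometric sum whose ratio [r ^+ 2] differs from 1 and has [n]-th power 1. *)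
Lemma sum_odd_powers n (i i' : 'I_n) : n.*2 = (3 ^ m - 1)%N ->
  \sum_(u < n) (beta ^+ u.*2.+1) ^+ i * (beta ^+ u.*2.+1)^-1 ^+ i'
    = (i == i')%:R *+ n.
Proof.
move=> def_n; have nz_beta := beta_neq0.
have [<- | ne_i] := eqVneq i i'.
  rewrite -[n in RHS]card_ord -sumr_const; apply: eq_bigr => u _.
  by rewrite -exprMn mulfV ?expr1n // expf_neq0.
rewrite mul0rn; set r := beta ^+ i / beta ^+ i'.
have r2 : r ^+ 2 != 1.
  rewrite expr_div_n -!exprM; apply: contra ne_i.
  rewrite -subr_eq0 -(mulfK (expf_neq0 (i' * 2) nz_beta) 1) -mulrBl.
  rewrite mulf_eq0 invr_eq0 (negPf (expf_neq0 _ nz_beta)) orbF mul1r subr_eq0.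
  rewrite (eq_prim_root_expr prim_beta) -def_n -!muln2.
  by rewrite !modn_small ?ltn_pmul2r // eqn_pmul2r.
have -> : \sum_(u < n) (beta ^+ u.*2.+1) ^+ i * (beta ^+ u.*2.+1)^-1 ^+ i'
    = r * \sum_(u < n) (r ^+ 2) ^+ u.
  rewrite mulr_sumr; apply: eq_bigr => u _.
  rewrite -[(r ^+ 2) ^+ u]exprM mul2n -exprS /r expr_div_n exprVn.
  by rewrite -!exprM ![(u.*2.+1 * _)%N]mulnC.
have rN : r ^+ (3 ^ m - 1)%N = 1.
  rewrite expr_div_n exprAC [X in _ / X]exprAC (prim_expr_order prim_beta).
  by rewrite !expr1n divr1.
have /eqP := subrX1 (r ^+ 2) n.
rewrite -exprM mul2n def_n rN subrr eq_sym mulf_eq0.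
by rewrite subr_eq0 (negPf r2) => /eqP ->; rewrite mulr0.
Qed.

(* Parseval: the two words have no common nonzero Fourier coefficient, because
   every odd exponent has 3-weight 1 or 3 modulo 4 and, [m] being odd, the
   classes are stable under negation. *)
Lemma weight_codes_orthogonal n (c c' : 'rV['F_3]_n) :
    odd m -> n.*2 = (3 ^ m - 1)%N ->
    c \in negacyclic_code n (gjm m 1 beta) ->
    c' \in negacyclic_code n (gjm m 3 beta) ->
  \sum_(i < n) c 0 i * c' 0 i = 0.
Proof.
move=> odd_m def_n /in_weight_code Cc /in_weight_code Cc'.
apply: (fmorph_inj (F3emb charF3)); rewrite rmorph0 rmorph_sum /=.
(* From 2n = 3^m - 1, [n] is 1 modulo 3, so the factor [n] of Parseval's identity disappears. *)
have n1 : n%:R = 1 :> F.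
  have p3 : 3%:R = 0 :> F by apply: pcharf0.
  have -> : n = (3 * (n %/ 3) + 1)%N.
    move: def_n; case: (m) odd_m => // m' _; rewrite expnS => def_n.
    have := expn_gt0 3 m'; lia.
  by rewrite natrD natrM p3 mul0r add0r.
transitivity (\sum_(u < n) word_eval charF3 c (beta ^+ u.*2.+1)
                         * word_eval charF3 c' (beta ^+ u.*2.+1)^-1).
  under [RHS]eq_bigr do rewrite mulr_suml.
  rewrite exchange_big; apply: eq_bigr => i _ /=.
  under [RHS]eq_bigr do rewrite mulr_sumr.
  have inner i' : \sum_(u < n) F3emb charF3 (c 0 i) * (beta ^+ u.*2.+1) ^+ i *
      (F3emb charF3 (c' 0 i') * (beta ^+ u.*2.+1)^-1 ^+ i')
      = F3emb charF3 (c 0 i) * F3emb charF3 (c' 0 i') * ((i == i')%:R *+ n).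
    rewrite -sum_odd_powers // mulr_sumr.
    by apply: eq_bigr => u _; rewrite mulrACA.
  rewrite exchange_big (bigD1 i) //= inner eqxx n1 mulr1 rmorphM.
  rewrite big1 ?addr0 // => i' ne_i.
  by rewrite inner eq_sym (negPf ne_i) mul0rn mulr0.
apply: big1 => u _; set e := u.*2.+1.
have lte : (e < 3 ^ m - 1)%N by rewrite -def_n /e; have := ltn_ord u; lia.
have odd_e : odd (wt3 m e) by rewrite odd_wt3 /e; lia.
have [wt1 | wt_3] : (wt3 m e %% 4 = 1)%N \/ (wt3 m e %% 4 = 3)%N by lia.
  by rewrite Cc ?mul0r // mem_wt3_exponents lte wt1.
have -> : (beta ^+ e)^-1 = beta ^+ (3 ^ m - 1 - e).
  apply: (mulIf (expf_neq0 e beta_neq0)).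
  by rewrite mulVf ?expf_neq0 ?beta_neq0 // -exprD subnK ?prim_expr_order // ltnW.
(* As [m] is odd, 2m is 2 modulo 4, so the complement of a weight 3 modulo 4 is again 3 modulo 4. *)
rewrite Cc' ?mulr0 // mem_wt3_exponents.
have := wt3_compl m e; move=> wte; apply/and3P; split; lia.
Qed.

End WeightCodes.

Theorem theorem44 (m : nat) (hm5 : (5 <= m)%N) (hmodd : odd m)
  (F : finFieldType) (hF : #|F| = (3 ^ m)%N)
  (beta : F) (hbeta : (3 ^ m - 1)%N.-primitive_root beta) :
  let n := ((3 ^ m - 1) %/ 2)%N in
  let C1 := negacyclic_code n (gjm m 1 beta) in
  let C3 := negacyclic_code n (gjm m 3 beta) in
  [/\ (code_dim C1)%:Z * 4 = (3 ^ m)%:Z - 1 + 2 * (-1) ^+ ((m + 1) %/ 2),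
      (forall c c', c \in C1 -> c' \in C1 -> c != c' ->
         (3 ^ ((m - 1) %/ 2))%:Z + 2 + (-1) ^+ ((m - 1) %/ 2) + 12
           <= (4 * hdist c c')%:Z),
      dual_code C1 = C3,
      (code_dim C3)%:Z * 4 = (3 ^ m)%:Z - 1 + 2 * (-1) ^+ ((m - 1) %/ 2)
    & (forall c c', c \in C3 -> c' \in C3 -> c != c' ->
         (3 ^ ((m - 1) %/ 2))%:Z - (-1) ^+ ((m - 1) %/ 2) + 8
           <= (4 * hdist c c')%:Z)].
Proof.
move=> n C1 C3.
have charF3 : 3 \in [pchar F] := card_finPcharP hF isT.
have def_n : n.*2 = (3 ^ m - 1)%N.
  by rewrite -muln2 divnK // dvdn2 oddB ?expn_gt0 // oddX orbT.
have [h def_m] : exists h, m = h.*2.+1.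
  by exists m./2; rewrite -[LHS](odd_double_half m) hmodd.
have -> : ((m + 1) %/ 2 = h.+1)%N by lia.
have -> : ((m - 1) %/ 2 = h)%N by lia.
have h_ge2 : (2 <= h)%N by lia.
(* The parity of [h] decides which of the two codes belongs to the class of [m] and which to that of
   [m + 2]. *)
have modA : (h.*2.+1 %% 4 = 1 + (odd h).*2)%N by lia.
have modB : (h.*2.+3 %% 4 = 3 - (odd h).*2)%N by lia.
have [count1 count3] := wt3_count_odd h.
rewrite -def_m in count1 count3.
(* The sign terms cancel in the sum. Hence the dimension of each code is the number of prescribed
   zeros of the other. *)
have count13 : (wt3_count m 1 + wt3_count m 3 = n)%N.
  have m3_gt0 : (0 < 3 ^ m)%N by rewrite expn_gt0.
  move: def_n m3_gt0 count1 count3; move: ((-1) ^+ h : int) => e.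
  move: (wt3_count m 1) (wt3_count m 3) (3 ^ m)%N (n) => a b p n'; lia.
have le1 : (wt3_count m 1 <= n)%N by rewrite -count13 leq_addr.
have le3 : (wt3_count m 3 <= n)%N by rewrite -count13 leq_addl.
have [G1 free_G1 def_C1] := weight_code_matrix _ charF3 _ _ hbeta n 1 isT le1.
have [G3 free_G3 def_C3] := weight_code_matrix _ charF3 _ _ hbeta n 3 isT le3.
have dim1 : code_dim C1 = wt3_count m 3.
  by rewrite /C1 def_C1 code_dim_rowspace (eqP free_G1) -count13 addKn.
have dim3 : code_dim C3 = wt3_count m 1.
  by rewrite /C3 def_C3 code_dim_rowspace (eqP free_G3) -count13 addnK.
have wt11 : wt3 1 1 = 1%N by rewrite /wt3 !big_ord_recl big_ord0.
have wt27 : wt3 2 7 = 3%N by rewrite /wt3 !big_ord_recl big_ord0.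
have distA j c c' : (h.*2.+1 %% 4 = j)%N ->
    c \in negacyclic_code n (gjm m j beta) ->
    c' \in negacyclic_code n (gjm m j beta) -> c != c' ->
    (3 ^ h < hdist c c')%N.
  move=> wt_j.
  apply: (weight_code_distance _ charF3 _ _ hbeta n j h h 1 1) => //.
    by rewrite def_m; lia.
  by rewrite wt11 addn1.
have distB j c c' : (h.*2.+3 %% 4 = j)%N ->
    c \in negacyclic_code n (gjm m j beta) ->
    c' \in negacyclic_code n (gjm m j beta) -> c != c' ->
    (3 ^ h.-1 < hdist c c')%N.
  move=> wt_j.
  apply: (weight_code_distance _ charF3 _ _ hbeta n j h h.-1 2 7) => //.
  - exact: leq_pred.
  - by rewrite def_m; lia.
  by rewrite wt27 addn3.
have h3E : (3 ^ h = 3 * 3 ^ h.-1)%N by rewrite -expnS prednK // ltnW.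
have h3_ge3 : (3 ^ 1 <= 3 ^ h.-1)%N.
  by rewrite leq_exp2l //; move: h_ge2; clear; lia.
split.
- by rewrite dim1 count3 exprS mulN1r mulrN.
- move=> c c' Cc Cc' ne_c; rewrite -signr_odd.
  have [odd_h | even_h] := boolP (odd h).
    (* The target 3^h + 13 <= 4 (3^(h-1) + 1) amounts to 3^(h-1) >= 9; an odd [h >= 2] is at least
       3. *)
    have h3_ge9 : (3 ^ 2 <= 3 ^ h.-1)%N.
      by rewrite leq_exp2l //; move: odd_h h_ge2; clear; lia.
    rewrite odd_h in modB; rewrite expr1.
    by move: (distB _ c c' modB Cc Cc' ne_c) h3E h3_ge9; clear; lia.
  rewrite (negPf even_h) in modA; rewrite expr0.
  by move: (distA _ c c' modA Cc Cc' ne_c) h3E h3_ge3; clear; lia.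
- rewrite /C1 /C3 def_C1 def_C3; apply: dual_code_orthogonal.
    by rewrite (eqP free_G1) (eqP free_G3) -count13 addKn addnK addnC.
  move=> c c' cG cG'.
  apply: (weight_codes_orthogonal _ charF3 _ _ hbeta) => //.
    by rewrite def_C1 inE.
  by rewrite def_C3 inE.
- by rewrite dim3 count1.
move=> c c' Cc Cc' ne_c; rewrite -signr_odd.
have [odd_h | even_h] := boolP (odd h).
  rewrite odd_h in modA; rewrite expr1.
  by move: (distA _ c c' modA Cc Cc' ne_c) h3E h3_ge3; clear; lia.
rewrite (negPf even_h) in modB; rewrite expr0.
(* Here 3^h + 7 <= 4 (3^(h-1) + 1) amounts to 3^(h-1) >= 3, with equality at [h = 2]. *)
by move: (distB _ c c' modB Cc Cc' ne_c) h3E h3_ge3; clear; lia.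
Qed.
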